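(* Let $a, c \in \mathbb{N}$ and $b, d \in \mathbb{Z}$, and suppose $R_{a,b,c,d}$ is non-empty. Then the following are equivalent: (i) $R_{a,b,c,d}$ is a set of (measurable) multiplicative recurrence; (ii) $R_{a,b,c,d}$ is a set of topological multiplicative recurrence; (iii) $a = c$ and $a \mid \mathrm{lcm}(b,d)$.
   Context: $\mathbb{N}=\{1,2,3,\dots\}$. For $a,c\in\mathbb{N}$, $b,d\in\mathbb{Z}$, define $R_{a,b,c,d} := \left\{ \frac{an+b}{cn+d} : n \in \mathbb{N} \right\} \cap (\mathbb{Q}_{>0}\setminus\{1\})$ (only $n$ with $cn+d\neq 0$ are considered). Convention: $\mathrm{lcm}(b,0)=0$, so $a\mid \mathrm{lcm}(b,d)$ holds automatically if $bd=0$. A set $R\subseteq \mathbb{Q}_{>0}\setminus\{1\}$ is a set of (measurable) multiplicative recurrence if for every measure-preserving action $T=(T_n)_{n\in\mathbb{N}}$ of the semigroup $(\mathbb{N},\times)$ on a probability space $(X,\mathcal{B},\mu)$ (i.e. each $T_n$ is measure-preserving and $T_{mn}=T_m\circ T_n$) and every $B\in\mathcal{B}$ with $\mu(B)>0$, there exist $m,n\in\mathbb{N}$ with $m/n\in R$ and $\mu(T_m^{-1}B\cap T_n^{-1}B)>0$. A set $R\subseteq \mathbb{Q}_{>0}\setminus\{1\}$ is a set of topological multiplicative recurrence if for every finite partition $\mathbb{N}=C_1\sqcup\cdots\sqcup C_s$ there is $i$ with $(C_i/C_i)\cap R\neq\emptyset$, where $C/C=\{m/n: m,n\in C\}$. 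*)

(* Defs.v *)
From HB Require Import structures.
From mathcomp Require Import all_boot all_order all_algebra.
From mathcomp Require Import all_classical all_reals all_analysis.
Set Implicit Arguments. Unset Strict Implicit. Unset Printing Implicit Defensive.
Import Order.TTheory GRing.Theory Num.Theory.
Local Open Scope classical_set_scope.
Local Open Scope ring_scope.

Definition Rset (a : nat) (b : int) (c : nat) (d : int) (q : rat) : Prop :=
  (exists n : nat, (0 < n)%N /\ (c%:Z * n%:Z + d != 0) /\
     q = ((a%:Z * n%:Z + b)%:~R / (c%:Z * n%:Z + d)%:~R : rat))
  /\ 0 < q /\ q != 1.

(* A measure-preserving action of the semigroup (N, x) on (X, mu); the maps are
   indexed by nat but only the indices n >= 1 are meaningful. *)
Definition mp_action (d : measure_display) (X : measurableType d) (R : realType)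
  (mu : probability X R) (T : nat -> X -> X) : Prop :=
  (forall n, (0 < n)%N -> measurable_fun setT (T n)) /\
  (forall n (A : set X), (0 < n)%N -> measurable A -> mu (T n @^-1` A) = mu A) /\
  (forall m n, (0 < m)%N -> (0 < n)%N -> T (m * n)%N = T m \o T n).

Definition mult_recurrence (S : rat -> Prop) : Prop :=
  forall (d : measure_display) (X : measurableType d) (R : realType)
    (mu : probability X R) (T : nat -> X -> X),
    mp_action mu T ->
    forall B : set X, measurable B -> (0 < mu B)%E ->
    exists m n : nat, [/\ (0 < m)%N, (0 < n)%N, S (m%:Q / n%:Q) &
      (0 < mu (T m @^-1` B `&` T n @^-1` B))%E].

(* Set of topological multiplicative recurrence: for every finite partition
   of N = {1,2,...} into s cells (given by a colouring), some cell C satisfies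
   (C/C) ∩ S <> ∅. *)
Definition top_mult_recurrence (S : rat -> Prop) : Prop :=
  forall (s : nat) (col : nat -> 'I_s),
    exists i : 'I_s, exists m n : nat,
      [/\ (0 < m)%N, (0 < n)%N, col m = i, col n = i & S (m%:Q / n%:Q)].

(* Main.v *)
Require Import Defs.
From HB Require Import structures.
From mathcomp Require Import all_boot all_order all_algebra.
From mathcomp Require Import all_classical all_reals all_analysis.
From mathcomp Require Import measurable_realfun Rstruct.
From mathcomp Require Import zify ring lra.
Import Order.TTheory GRing.Theory Num.Theory.
Import numFieldNormedType.Exports.
Local Open Scope ring_scope.

(* If a = c and a | lcm(b, d), then a = a1 a2 with a1, a2 coprime, a1 | b and a2 | d. There
   are arbitrarily long sequences x_1 < ... < x_r all of whose ratios x_j / x_i (i < j)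
   lie in R (or in 1/R, when b < d): a sequence x_1, ..., x_r is prolonged to
   P + x_1, ..., P + x_r, P + D by the Chinese remainder theorem. Both kinds of recurrence
   follow by the pigeonhole principle, applied to the colours of the x_i or to the
   preimages of B under the T_{x_i}.
   If a <> c, the elements of R accumulate only at a/c. For all but countably many alpha,
   alpha ln q is not an integer for any rational q <> 1, so that it stays away from the
   integers for q in R; the rotations of the circle by alpha ln n then contradict
   recurrence.
   If a = c does not divide lcm(b, d), some prime p satisfies v_p(b), v_p(d) < v_p(a). If
   v_p(b) and v_p(d) differ, then v_p is a nonzero constant on R; otherwise the prime-to-p
   parts of a n + b and a n + d are distinct modulo a fixed power of p. The action by
   rotation by v_p(n) / M, respectively by multiplication by the prime-to-p part of n
   modulo that power of p, contradicts recurrence. *)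

(** * Coprimality and the Chinese remainder theorem *)

Lemma subn_compl (i j n : nat) : (i <= j -> j <= n -> j - i = (n - i) - (n - j))%N.
Proof. lia. Qed.

Lemma coprime_primes (m n : nat) : (0 < m)%N ->
  (forall p, prime p -> (p %| m)%N -> ~~ (p %| n)%N) -> coprime m n.
Proof.
move=> m0 H; rewrite /coprime; apply: contraT => g1.
have g2 : (1 < gcdn m n)%N by rewrite ltn_neqAle eq_sym g1 gcdn_gt0 m0.
have := pdiv_dvd (gcdn m n); rewrite dvdn_gcd => /andP[d1 d2].
by have := H _ (pdiv_prime g2) d1; rewrite d2.
Qed.

Lemma coprime_solve_dvdn (K z c : nat) :
  (0 < z)%N -> coprime K z -> exists k, (z %| K * k + c)%N.
Proof.
(* [c * z.-1] stands for [-c] modulo [z]. *)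
move=> z0 cKz; pose v := chinese K z 0 (c * z.-1).
have Kv : (K %| v)%N by rewrite /dvdn (chinese_modl cKz) mod0n.
exists (v %/ K)%N; rewrite mulnC (divnK Kv) /dvdn -modnDml.
rewrite (chinese_modr cKz) modnDml -{2}(muln1 c) -mulnDr addn1 prednK //.
by rewrite modnMl.
Qed.

(** Induction on [s]: adding to [P] a multiple of [N] and of the earlier moduli keeps what was
    achieved; their product is coprime to the new modulus, so some multiple meets the new
    condition. *)
Lemma crt_seq {N : nat} (L : nat) {z : nat -> nat} {s : seq nat} :
  (0 < N)%N -> uniq s -> {in s, forall x, 0 < z x}%N ->
  {in s, forall x, coprime N (z x)} ->
  {in s &, forall x y, x != y -> coprime (z x) (z y)} ->
  exists P, [/\ (L <= P)%N, (N %| P)%N & {in s, forall x, z x %| P + x}%N].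
Proof.
move=> N0 + z0 cN; elim: s z0 cN => [|x s IH] z0 cN /=.
  by move=> _ _; exists (N * L)%N; rewrite dvdn_mulr // leq_pmull.
move=> /andP[xs us] cz.
have [||||P [LP NP zP]] := IH => //.
- by move=> y ys; apply: z0; rewrite inE ys orbT.
- by move=> y ys; apply: cN; rewrite inE ys orbT.
- by move=> y y' ys ys'; apply: cz; rewrite inE ?ys ?ys' orbT.
pose K := (N * \prod_(y <- s) z y)%N.
have cK : coprime K (z x).
  rewrite coprimeMl cN ?mem_head //= big_seq.
  elim/big_ind: _ => [|u v cu cv|y ys]; first exact: coprime1n.
    by rewrite coprimeMl cu.
  apply: cz; rewrite ?inE ?eqxx ?ys ?orbT //.
  by apply: contraNneq xs => <-.
have [||k zk] := coprime_solve_dvdn K (z x) (P + x) => //.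
  by apply: z0; rewrite mem_head.
exists (P + K * k)%N; split.
- by rewrite (leq_trans LP) // leq_addr.
- by rewrite dvdn_add // -mulnA dvdn_mulr.
- move=> y; rewrite inE => /predU1P[->|ys]; first by rewrite addnAC addnC.
  rewrite addnAC dvdn_add ?zP // /K (big_rem y) //=.
  by rewrite mulnCA -!mulnA dvdn_mulr.
Qed.

(** * Sequences of pairwise good numbers *)

(* For [b > d], [y / x] lies in R_{a,b,a,d} iff (b - d) x / (y - x) = a n + d for some
   n >= 1. When [a = a1 * a2] with [a1] and [a2] coprime, [a1 | b] and [a2 | d], this
   relation forces it; [W] only serves to make [n] positive. *)
Definition good (a1 a2 W x y : nat) :=
  [&& x < y, a1 * (y - x) %| y, a2 * (y - x) %| x & W * (y - x) <= x]%N.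

Lemma good_scale (a1 a2 W k x y : nat) : (0 < k)%N ->
  good a1 a2 W x y -> good a1 a2 W (k * x) (k * y).
Proof.
move=> k0 /and4P[xy d1 d2 W1]; apply/and4P; split.
- by rewrite ltn_pmul2l.
- by rewrite -mulnBr mulnCA dvdn_mul.
- by rewrite -mulnBr mulnCA dvdn_mul.
- by rewrite -mulnBr mulnCA leq_pmul2l.
Qed.

Lemma good_shift (a1 a2 W P x y : nat) :
  (a1 * (y - x) %| P)%N -> (a2 * (y - x) %| P)%N ->
  good a1 a2 W x y -> good a1 a2 W (P + x) (P + y).
Proof.
move=> P1 P2 /and4P[xy d1 d2 W1]; apply/and4P; split.
- by rewrite ltn_add2l.
- by rewrite subnDl dvdn_add.
- by rewrite subnDl dvdn_add.
- by rewrite subnDl (leq_trans W1) // leq_addl.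
Qed.

(* [D] is prime to [a2] and divisible by high powers of all the other primes dividing the
   elements of [s] and their differences. Hence, up to the part [g x] of [x] prime to
   [a2], the differences [D - x] are pairwise coprime and coprime to those primes, and
   the Chinese remainder theorem provides [P]. *)
Lemma good_extend (a1 a2 W : nat) (s : seq nat) :
  (0 < a1)%N -> (0 < a2)%N -> coprime a1 a2 ->
  all (fun x => 0 < x)%N s -> all (fun x => a2 %| x)%N s ->
  pairwise (fun y x => good a1 a2 W x y) s ->
  exists D P : nat,
    pairwise (fun y x => good a1 a2 W x y) ((P + D)%N :: [seq (P + x)%N | x <- s]) /\
    (0 < P + D)%N.
Proof.
move=> a10 a20 ca /allP s0 /allP sa2 gs.
pose B := (\max_(x <- s) x)%N.
have sB x : x \in s -> (x <= B)%N by move=> xs; apply: leq_bigmax_seq.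
pose M := (a1 * a2 * B`!)%N.
have M0 : (0 < M)%N by rewrite !muln_gt0 a10 a20 fact_gt0.
have dM n : (0 < n <= B)%N -> (n %| M)%N by move=> nB; rewrite dvdn_mull // dvdn_fact.
pose pi := \pi(a2).
pose M1 := (M`_pi^')%N.
have M10 : (0 < M1)%N by rewrite part_gt0.
(* [t] is 1 modulo [a2] and exceeds [B], so [D] is prime to [a2] and exceeds all of [s]. Of the two
   factors [M1], one absorbs [g x]; the other keeps [D / g x] divisible by [a1] and by the primes of
   [M] outside [a2]. *)
pose t := (a2 * B).+1.
pose D := (M1 * (M1 * t))%N.
have BD : (B < D)%N.
  by rewrite /D mulnA (@leq_trans t) ?leq_pmull ?muln_gt0 ?M10 // ltnS leq_pmull.
have pi_p p : prime p -> (p %| a2)%N = (p \in pi).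
  by move=> pp; rewrite mem_primes pp a20.
have M1p p : prime p -> (p %| a2)%N -> ~~ (p %| M1)%N.
  move=> pp pa; apply/negP => pM.
  have := pnat_dvd pM (part_pnat _ _).
  by rewrite pnatE // inE /= -pi_p // pa.
have tp p : prime p -> (p %| a2)%N -> ~~ (p %| t)%N.
  move=> pp pa; rewrite /t -addn1 dvdn_addr ?dvdn_mulr //.
  by rewrite dvdn1 neq_ltn prime_gt1 ?orbT.
have Dp p : prime p -> (p %| a2)%N -> ~~ (p %| D)%N.
  by move=> pp pa; rewrite /D !Euclid_dvdM // !negb_or M1p //= tp.
pose g x := (x`_pi^')%N.
have gM1 x : x \in s -> (g x %| M1)%N.
  by move=> xs; apply: partn_dvd => //; apply: dM; rewrite s0 //= sB.
have g0 x : (0 < g x)%N by rewrite part_gt0.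
have gD x : x \in s -> (g x %| D)%N by move=> xs; rewrite /D dvdn_mulr // gM1.
have gx x : (g x %| x)%N by exact: dvdn_part.
pose z x := ((D - x) %/ g x)%N.
have Dz x : x \in s -> (D - x = g x * z x)%N.
  by move=> xs; rewrite mulnC divnK // dvdn_sub ?gD ?gx.
have z0 x : x \in s -> (0 < z x)%N.
  move=> xs; have : (0 < D - x)%N by rewrite subn_gt0 (leq_ltn_trans _ BD) ?sB.
  by rewrite Dz // muln_gt0 => /andP[].
have DE x : x \in s -> (D %/ g x = z x + (x`_pi)%N)%N.
  move=> xs; have xD : (x <= D)%N by rewrite ltnW // (leq_ltn_trans _ BD) ?sB.
  apply/eqP; rewrite -(eqn_pmul2l (g0 x)) mulnDr -Dz // mulnC divnK ?gD //.
  by rewrite mulnC partnC ?s0 // subnK.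
(* By [DE], [z x] is the difference of [D / g x] and the [pi]-part of [x]. Exactly one of these is
   divisible by [p]: the latter if [p] divides [a2], since [a2] divides [x], and the former
   otherwise. *)
have pz x p : x \in s -> prime p -> (p %| M)%N -> ~~ (p %| z x)%N.
  move=> xs pp pM; have DEx := DE x xs; have [pa|pa] := boolP (p %| a2)%N.
    apply: contra (Dp p pp pa) => pzx.
    rewrite -(divnK (gD x xs)) dvdn_mulr // DEx dvdn_add //.
    have := sa2 x xs; rewrite -{1}(partnC pi (s0 x xs)) => ax.
    have := dvdn_trans pa ax; rewrite Euclid_dvdM // => /orP[//|pg].
    by have := pnat_dvd pg (part_pnat _ _); rewrite pnatE // inE /= -pi_p // pa.
  have pM1 : (p %| M1)%N.
    move: pM; rewrite -(partnC pi M0) Euclid_dvdM // => /orP[pg|//].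
    by have := pnat_dvd pg (part_pnat _ _); rewrite pnatE // -pi_p // (negbTE pa).
  apply/negP => pzx.
  have : (p %| z x + (x`_pi)%N)%N.
    by rewrite -DEx /D mulnC -muln_divA ?gM1 // -mulnA dvdn_mulr.
  rewrite dvdn_addr // => pg; have := pnat_dvd pg (part_pnat _ _).
  by rewrite pnatE // -pi_p // (negbTE pa).
have zM x : x \in s -> coprime M (z x).
  by move=> xs; apply: coprime_primes => // p pp pM; apply: pz.
have us : uniq s.
  apply: pairwise_uniq gs => x; rewrite /good ltnn //.
(* A common prime of [z x] and [z y] divides [y - x <= B], hence [M], against [pz]. *)
have czlt : {in s &, forall x y, (x < y)%N -> coprime (z x) (z y)}.
  move=> x y xs ys xy; apply: coprime_primes; first exact: z0.
  move=> p pp pzx; apply/negP => pzy.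
  have px : (p %| D - x)%N by rewrite Dz // dvdn_mull.
  have py : (p %| D - y)%N by rewrite Dz // dvdn_mull.
  have pyx : (p %| y - x)%N.
    by rewrite (subn_compl _ _ _ (ltnW xy) (ltnW (leq_ltn_trans (sB y ys) BD))) dvdn_sub.
  suff pM : (p %| M)%N by have := pz x p xs pp pM; rewrite pzx.
  apply: dvdn_trans pyx _; apply: dM; rewrite subn_gt0 xy /=.
  by rewrite (leq_trans (leq_subr _ _)) ?sB.
have cz : {in s &, forall x y, x != y -> coprime (z x) (z y)}.
  move=> x y xs ys; rewrite neq_ltn => /orP[]; first exact: czlt.
  by rewrite coprime_sym; apply: czlt.
have MM0 : (0 < M * M)%N by rewrite muln_gt0 M0.
have zMM x : x \in s -> coprime (M * M) (z x) by move=> xs; rewrite coprimeMl zM.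
(* [M * M] is a multiple of all [a1 * g x], [a2 * g x], [a1 * (y - x)] and [a2 * (y - x)]; the bound
   [W * D] yields the last clause of [good]. *)
have [P [LP NP zP]] := crt_seq (W * D) MM0 us z0 zMM cz.
have a1M : (a1 %| M)%N by rewrite /M -mulnA dvdn_mulr.
have a2M : (a2 %| M)%N by rewrite /M mulnAC dvdn_mull.
have M1M : (M1 %| M)%N by exact: dvdn_part.
have a1M1 : (a1 %| M1)%N.
  rewrite -(Gauss_dvdr _ (_ : coprime a1 (M`_pi)%N)) ?partnC //.
  apply: coprime_primes => // p pp pa1; apply/negP => pM.
  have := pnat_dvd pM (part_pnat _ _); rewrite pnatE // -pi_p // => pa2.
  have : (p %| gcdn a1 a2)%N by rewrite dvdn_gcd pa1.
  by rewrite (eqP ca) dvdn1 => /eqP p1; rewrite p1 in pp.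
exists D, P; split; last by rewrite addn_gt0 (leq_ltn_trans _ BD) ?orbT.
rewrite pairwise_cons; apply/andP; split.
  rewrite all_map; apply/allP => x xs /=.
  have xB := sB x xs; have xD : (x < D)%N by rewrite (leq_ltn_trans xB).
  have gM : (g x %| M)%N by rewrite (dvdn_trans (gM1 x xs)).
  apply/and4P; rewrite subnDl; split.
  - by rewrite ltn_add2l.
  (* [a1 * g x] divides [P] and [D], and [z x], coprime to it, divides [P + x] and [D - x]. *)
  - rewrite Dz // mulnA Gauss_dvd; last first.
      exact: coprime_dvdl (dvdn_mul a1M gM) (zMM x xs).
    rewrite dvdn_add /=; last 2 first.
    + exact: dvdn_trans (dvdn_mul a1M gM) NP.
    + by rewrite /D dvdn_mul // dvdn_mulr ?gM1.
    rewrite (_ : P + D = P + x + (D - x))%N; last by rewrite -addnA subnKC // ltnW.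
    by rewrite dvdn_add ?zP // Dz // dvdn_mull.
  - rewrite Dz // mulnA Gauss_dvd; last first.
      exact: coprime_dvdl (dvdn_mul a2M gM) (zMM x xs).
    rewrite zP // andbT dvdn_add //.
      exact: dvdn_trans (dvdn_mul a2M gM) NP.
    rewrite Gauss_dvd ?sa2 ?gx //.
    apply: coprime_primes => // p pp pa2; apply/negP => pg.
    by have := pnat_dvd pg (part_pnat _ _); rewrite pnatE // inE /= -pi_p // pa2.
  - by rewrite (leq_trans _ (leq_addr _ _)) // (leq_trans _ LP) // leq_mul2l leq_subr orbT.
rewrite pairwise_map; apply: sub_in_pairwise (allss s) gs => y x ys xs /= gxy.
have /and4P[xy _ _ _] := gxy.
have dyx : (y - x %| M)%N.
  by apply: dM; rewrite subn_gt0 xy (leq_trans (leq_subr _ _)) ?sB.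
by apply: good_shift gxy; apply: dvdn_trans NP; rewrite dvdn_mul.
Qed.

(** Induction on [r]: scaling by [a2] preserves [good] and supplies the multiples of [a2] that
    [good_extend] asks for. Each new element is the largest and goes to the head, so the list
    decreases. *)
Lemma good_seq (a1 a2 W r : nat) :
  (0 < a1)%N -> (0 < a2)%N -> coprime a1 a2 ->
  exists s : seq nat, [/\ size s = r, all (fun x => 0 < x)%N s &
    pairwise (fun y x => good a1 a2 W x y) s].
Proof.
move=> a10 a20 ca; elim: r => [|r [s [sr s0 gs]]]; first by exists [::].
have [||||||D [P [gP P0]]] := @good_extend a1 a2 W [seq (a2 * x)%N | x <- s] => //.
- by rewrite all_map; apply: sub_all s0 => x /= x0; rewrite muln_gt0 a20.
- by rewrite all_map; apply/allP => x _ /=; rewrite dvdn_mulr.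
- by rewrite pairwise_map; apply: sub_pairwise gs => y x /= /good_scale; apply.
eexists; split; last exact: gP.
- by rewrite /= !size_map sr.
- rewrite /= P0 -map_comp all_map; apply: sub_all s0 => x /= x0.
  by rewrite addn_gt0 muln_gt0 a20 x0 orbT.
Qed.

(** * From good pairs to elements of R *)

(** [a1] collects the prime powers of [a] that divide [b]. The remaining ones divide [d], since the
    valuation of the lcm is the maximum of the two. *)
Lemma split_dvd_lcm {a : nat} {b d : int} : (0 < a)%N -> (a%:Z %| lcmz b d)%Z ->
  exists a1 a2, [/\ a = (a1 * a2)%N, coprime a1 a2, (a1%:Z %| b)%Z & (a2%:Z %| d)%Z].
Proof.
move=> a0 alcm.
have [->|b0] := eqVneq b 0.
  by exists a, 1%N; rewrite muln1 coprimen1 dvdz0 dvd1z.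
have [->|d0] := eqVneq d 0.
  by exists 1%N, a; rewrite mul1n coprime1n dvdz0 dvd1z.
have {}alcm : (a %| lcmn `|b| `|d|)%N by move: alcm; rewrite /lcmz dvdzE.
have bn0 : (0 < `|b|)%N by rewrite absz_gt0.
have dn0 : (0 < `|d|)%N by rewrite absz_gt0.
pose pi := [pred p | logn p a <= logn p `|b|]%N : nat_pred.
exists (a`_pi)%N, (a`_(pi^'))%N; rewrite partnC // coprime_partC; split=> //.
- rewrite dvdzE /=; apply/(dvdn_partP _ (part_gt0 _ _)) => p.
  rewrite pi_of_part // => /andP[pa ppi].
  rewrite partn_part; last by move=> q /eqP ->.
  by rewrite p_part pfactor_dvdn //; move: pa; rewrite mem_primes => /andP[].
- rewrite dvdzE /=; apply/(dvdn_partP _ (part_gt0 _ _)) => p.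
  rewrite pi_of_part // => /andP[pa]; rewrite !inE -ltnNge => lt_b.
  have pp : prime p by move: pa; rewrite mem_primes => /andP[].
  rewrite partn_part; last by move=> q /eqP ->; rewrite !inE -ltnNge.
  rewrite p_part pfactor_dvdn //.
  have := dvdn_leq_log p _ alcm; rewrite lcmn_gt0 bn0 dn0 => /(_ isT).
  by rewrite logn_lcm // leq_max leqNgt lt_b.
Qed.

(** Put [D = y - x], [y = a1 l D], [x = a2 k D], so that [a1 l = a2 k + 1]. Then [u = (b - d) a2 k]
    is congruent to [d] modulo [a2], and also modulo [a1] because [u - d = (b - d) a1 l - b]. Hence
    [u = a1 a2 n + d], and the element of R given by [n] is [a1 l / (a2 k) = y / x]. The bound on
    [x] forces [n > 0]. *)
Lemma good_Rset {a1 a2 x y : nat} {b d : int} :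
  (0 < a1)%N -> (0 < a2)%N -> coprime a1 a2 -> (a1%:Z %| b)%Z -> (a2%:Z %| d)%Z ->
  d < b -> (0 < x)%N -> good a1 a2 (a1 * a2 + `|d|) x y ->
  Rset (a1 * a2) b (a1 * a2) d (y%:Q / x%:Q).
Proof.
move=> a10 a20 ca a1b a2d db x0 /and4P[xy d1 d2 W].
have D0 : (0 < y - x)%N by rewrite subn_gt0.
move: d1 d2; move: (y - x)%N (subnKC (ltnW xy)) D0 W => D yE D0 W.
move=> /dvdnP[l yl] /dvdnP[k xk].
have akl : (a1 * l = a2 * k + 1)%N.
  by apply/eqP; rewrite -(eqn_pmul2r D0); apply/eqP; lia.
have kW : (a1 * a2 + `|d| <= a2 * k)%N.
  by rewrite -(leq_pmul2r D0) (leq_trans W) // xk; lia.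
pose u : int := (b - d) * (a2 * k)%:Z.
have uE : u + (b - d) = (b - d) * (a1 * l)%:Z by rewrite akl /u; lia.
have : ((a1 * a2)%N%:Z %| u - d)%Z.
  rewrite PoszM Gauss_dvdz //; apply/andP; split; last first.
    by rewrite rpredB // /u PoszM dvdz_mull // dvdz_mulr.
  rewrite (_ : u - d = (b - d) * (a1 * l)%:Z - b); last by rewrite -uE; lia.
  by rewrite rpredB // PoszM dvdz_mull // dvdz_mulr.
move=> /dvdzP[n nE].
have ud : u - d >= (a1 * a2)%N%:Z.
  rewrite /u; have : `|d|%N%:Z >= d by lia.
  have : (b - d) >= 1 by lia.
  move: kW; move: (a1 * a2)%N (a2 * k)%N => A K; nia.
have n0 : 0 < n.
  have A0 : 0 < (a1 * a2)%N%:Z by rewrite ltz_nat muln_gt0 a10.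
  by rewrite -(pmulr_lgt0 _ A0) -nE (lt_le_trans A0).
have x0Q : (x%:Q != 0) by rewrite intr_eq0; lia.
have y0 : (0 < y)%N by lia.
have K0 : (0 < a2 * k)%N.
  by rewrite (leq_trans _ kW) // (leq_trans _ (leq_addr _ _)) // muln_gt0 a10.
have u0 : u != 0.
  rewrite /u mulf_eq0 negb_or subr_eq0 gt_eqF //=.
  by rewrite eqz_nat -lt0n.
split; [exists `|n|%N; split; [lia|split]|split].
- by rewrite gez0_abs ?ltW // mulrC -nE subrK.
- rewrite gez0_abs ?ltW // ![(a1 * a2)%N%:Z * _]mulrC -nE subrK.
  rewrite (_ : u - d + b = u + (b - d)); last by lia.
  apply/eqP; rewrite eqr_div // ?intr_eq0 // -!intrM eqr_int uE /u; apply/eqP.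
  rewrite yl xk; lia.
- by rewrite divr_gt0 // ltr0z; lia.
- apply/eqP => E; have : y%:Q = x%:Q by rewrite -(divfK x0Q y%:Q) E mul1r.
  by move=> /intr_inj; lia.
Qed.

Lemma Rset_inv {a c : nat} {b d : int} {q : rat} :
  Rset a b c d q -> Rset c d a b q^-1.
Proof.
move=> [[n [n0 [dn qE]]] [q0 q1]].
split; last by rewrite invr_gt0 q0 invr_eq1.
exists n; split=> //; split; last by rewrite qE invf_div.
apply: contraTneq q0 => an0.
by rewrite qE an0 mul0r ltxx.
Qed.

(** * Long chains of ratios imply both kinds of recurrence *)

(** Either direction of the ratio will do: recurrence lets [m] and [n] be exchanged, and the sign of
    [b - d] decides the direction. *)
Definition long_ratio_chains (S : rat -> Prop) : Prop :=
  forall r : nat, exists x : nat -> nat,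
    (forall i, (i < r)%N -> (0 < x i)%N) /\
    forall i j, (i < j < r)%N -> S ((x i)%:Q / (x j)%:Q) \/ S ((x j)%:Q / (x i)%:Q).

Lemma Rset_chains {a : nat} {b d : int} : (0 < a)%N -> b != d ->
  (a%:Z %| lcmz b d)%Z -> long_ratio_chains (Rset a b a d).
Proof.
move=> a0; wlog bd : b d / d < b => [H bd aL r|].
  have [lt|gt|E] := ltgtP d b; [exact: H| |by rewrite E eqxx in bd].
  rewrite eq_sym in bd; rewrite lcmzC in aL.
  have [x [x0 Hx]] := H d b gt bd aL r; exists x; split=> // i j ij.
  by case: (Hx i j ij) => /Rset_inv; rewrite invf_div; [right|left].
move=> _ aL r; have [a1 [a2 [aE ca a1b a2d]]] := split_dvd_lcm a0 aL.
move: a0; rewrite aE muln_gt0 => /andP[a10 a20].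
have [s [<- /all_nthP s0 /(pairwiseP 0%N) gs]] :=
  good_seq a1 a2 (a1 * a2 + `|d|) r a10 a20 ca.
exists (nth 0%N s); split=> [i|i j /andP[ij js]]; first exact: s0.
left; have is_ := ltn_trans ij js; apply: good_Rset => //; first exact: s0.
exact: gs.
Qed.

Lemma chains_top_recurrence {S : rat -> Prop} :
  long_ratio_chains S -> top_mult_recurrence S.
Proof.
move=> HS s col; have [x [x0 Sx]] := HS s.+1.
have : ~~ injectiveb (fun i : 'I_s.+1 => col (x i)).
  by apply/negP => /injectiveP /leq_card; rewrite !card_ord ltnn.
case/injectivePn => i [j]; wlog ij : i j / (i < j)%N => [H ij E|_ E].
  case: (ltngtP i j) => [lt|gt|/val_inj e]; last by rewrite e eqxx in ij.
    exact: (H i j).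
  by apply: (H j i) => //; rewrite eq_sym.
exists (col (x i)).
case: (Sx i j); rewrite ?ij ?ltn_ord // => H.
  by exists (x i), (x j); split; rewrite ?x0.
by exists (x j), (x i); split; rewrite ?x0.
Qed.

Local Open Scope classical_set_scope.
Local Open Scope ereal_scope.

(** If all pairwise intersections were null, the union of the first [k] sets would have measure
    [k * e], which exceeds 1 at [k = r]. *)
Lemma measure_pigeonhole {d} {X : measurableType d} {R : realType}
    (mu : probability X R) (A : nat -> set X) (e : R) (r : nat) :
  (forall i, (i < r)%N -> measurable (A i) /\ mu (A i) = e%:E) ->
  (1 < r%:R * e)%R ->
  exists i j, (i < j < r)%N /\ 0 < mu (A i `&` A j).
Proof.
move=> mA re1; apply: contrapT => nA.
have A0 i j : (i < j < r)%N -> mu (A i `&` A j) = 0.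
  move=> ij; apply/eqP; rewrite eq_le measure_ge0 andbT leNgt; apply/negP => H.
  by apply: nA; exists i, j.
pose U k := \big[setU/set0]_(i < k) A i.
have mU k : (k <= r)%N -> measurable (U k).
  move=> kr; apply: bigsetU_measurable => i _; apply: (mA i _).1.
  exact: leq_trans (ltn_ord i) kr.
suff H k : (k <= r)%N -> mu (U k) = (k%:R * e)%:E.
  have := probability_le1 mu (mU r (leqnn _)).
  by rewrite H // lee_fin leNgt re1.
elim: k => [|k IH] kr; first by rewrite /U big_ord0 measure0 mul0r.
have [mAk Ak] := mA k kr; have mUk := mU k (ltnW kr).
have UA0 : mu (U k `&` A k) = 0.
  suff UA0 j : (j <= k)%N -> mu (U j `&` A k) = 0 by exact: UA0.
  rewrite /U; elim: j => [|j IHj] jk; first by rewrite big_ord0 set0I measure0.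
  have jr : (j < r)%N by exact: ltn_trans jk kr.
  rewrite big_ord_recr /= setIUl; apply: null_set_setU.
  - by apply: measurableI => //; apply: mU; apply: ltnW.
  - by apply: measurableI => //; apply: (mA j jr).1.
  - by apply: IHj; apply: ltnW.
  - by apply: A0; rewrite jk.
have -> : U k.+1 = U k `|` A k by rewrite /U big_ord_recr.
rewrite measureUfinr //= Ak ?ltry // UA0 IH ?(ltnW kr) // sube0 -EFinD.
by rewrite -natr1 mulrDl mul1r.
Qed.

Lemma chains_mult_recurrence {S : rat -> Prop} :
  long_ratio_chains S -> mult_recurrence S.
Proof.
move=> HS d X R mu T [mT [muT _]] B mB B0.
have muBfin : mu B \is a fin_num by exact: fin_num_measure.
have e0 : (0 < fine (mu B))%R by rewrite -lte_fin fineK.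
pose r := (Num.bound (fine (mu B))^-1).
have re : (1 < r%:R * fine (mu B))%R.
  rewrite -ltr_pdivrMr // mul1r /r archi_boundP // invr_ge0 ltW //.
have [x [x0 Sx]] := HS r.
have [|i [j [ij muij]]] := measure_pigeonhole mu (fun i => T (x i) @^-1` B) _ r _ re.
  move=> i ir; split; first by rewrite -[X in measurable X]setTI; apply: mT => //; apply: x0.
  by rewrite fineK // muT //; apply: x0.
have /andP[ij' jr] := ij; have ir := ltn_trans ij' jr.
case: (Sx i j ij) => H.
  by exists (x i), (x j); split=> //; apply: x0.
by exists (x j), (x i); split=> //; [exact: x0|exact: x0|rewrite setIC].
Qed.

Local Close Scope ereal_scope.

(** * Rotations of the circle *)

Definition frac {R : realType} (x : R) : R := x - (Num.floor x)%:~R.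

Lemma frac_itv {R : realType} (x : R) : 0 <= frac x < 1.
Proof.
have /andP[h1 h2] := floor_itv x.
by rewrite /frac subr_ge0 h1 ltrBlDr addrC -intrD1.
Qed.

Lemma frac_eq {R : realType} {x y : R} (k : int) :
  0 <= y < 1 -> x = y + k%:~R -> frac x = y.
Proof.
move=> /andP[y0 y1] ->; rewrite /frac.
rewrite (@floor_def _ _ k) ?addrK //.
by rewrite lerDr y0 /= intrD1 [ltRHS]addrC ltrD2r.
Qed.

Lemma frac_fracD {R : realType} (x y : R) : frac (frac x + y) = frac (x + y).
Proof.
apply: (frac_eq (- Num.floor x + Num.floor (x + y))); first exact: frac_itv.
by rewrite intrD intrN /frac; ring.
Qed.

Lemma measurable_frac {R : realType} : measurable_fun setT (@frac R).
Proof.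
apply: measurable_funB; first exact: measurable_id.
apply: nondecreasing_measurable => // x y xy.
by rewrite ler_int; exact: le_floor.
Qed.

Lemma measurable_shift {R : realType} (t : R) :
  measurable_fun setT (fun x : measurableTypeR R => (x + t : measurableTypeR R)).
Proof. exact: measurable_funD. Qed.

(** The image measure under the translation agrees with Lebesgue measure on half-open intervals,
    which determine it. *)
Lemma lebesgue_measure_shift {R : realType} (t : R) (A : set (measurableTypeR R)) :
  measurable A -> lebesgue_measure ((fun x : R => x + t) @^-1` A) = lebesgue_measure A.
Proof.
move=> mA.
pose f : {mfun measurableTypeR R >-> measurableTypeR R} :=
  HB.pack (fun x : measurableTypeR R => (x + t : measurableTypeR R))
    (isMeasurableFun.Build _ _ _ _ _ (measurable_shift t)).
apply/esym.
apply: (@lebesgue_measure_unique R (pushforward lebesgue_measure f)) => //= _ [[a b]] _ <-.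
rewrite /pushforward /f /=.
have -> : (fun x : R => x + t) @^-1` `]a, b] = `]a - t, b - t]%classic.
  by apply/seteqP; split => x /=; rewrite !in_itv /= ltrBlDr lerBrDr.
rewrite !lebesgue_measure_itv /= !lte_fin ltrD2r; case: ifP => // _.
by rewrite -!EFinD; congr EFin; ring.
Qed.

(** The circle is modelled on the whole line, with all mass on the fundamental domain [0, 1), so
    that rotations are plain maps of the line. *)
Definition unit_itv_measure (R : realType) : set (measurableTypeR R) -> \bar R :=
  mrestr (@lebesgue_measure R) (measurable_itv `[(0 : R), 1[%R).

HB.instance Definition _ (R : realType) := Measure.on (unit_itv_measure R).

Lemma unit_itv_measureE {R : realType} (A : set (measurableTypeR R)) :
  unit_itv_measure R A = lebesgue_measure (A `&` `[(0 : R), 1[).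
Proof. by []. Qed.

Lemma unit_itv_measureT (R : realType) : unit_itv_measure R setT = 1%E.
Proof.
by rewrite unit_itv_measureE setTI lebesgue_measure_itv /= lte_fin ltr01 oppr0 addr0.
Qed.

HB.instance Definition _ (R : realType) :=
  Measure_isProbability.Build _ _ _ (unit_itv_measure R) (unit_itv_measureT R).

(** A rotation exchanges two intervals: cutting [A] at [s = frac t], the preimage inside [0, 1)
    consists of a translate of each piece, by [s] and by [s - 1] in the preimage maps. *)
Lemma unit_itv_measure_rot {R : realType} (t : R) (A : set (measurableTypeR R)) :
  measurable A ->
  unit_itv_measure R ((fun x => frac (x + t)) @^-1` A) = unit_itv_measure R A.
Proof.
move=> mA; pose s := frac t; have /andP[s0 s1] : 0 <= s < 1 := frac_itv t.
rewrite !unit_itv_measureE.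
pose A1 := A `&` `[s, 1[%classic : set (measurableTypeR R).
pose A2 := A `&` `[0, s[%classic : set (measurableTypeR R).
have mA1 : measurable A1 by exact: measurableI.
have mA2 : measurable A2 by exact: measurableI.
have msh u (C : set (measurableTypeR R)) :
    measurable C -> measurable ((fun x : R => x + u) @^-1` C : set (measurableTypeR R)).
  by move=> mC; rewrite -[X in measurable X]setTI; exact: measurable_shift.
have -> : (fun x => frac (x + t)) @^-1` A `&` `[0, 1[%classic =
    ((fun x : R => x + s) @^-1` A1) `|` ((fun x : R => x + (s - 1)) @^-1` A2).
  have fE x : frac (x + t) = frac (x + s) by rewrite addrC -(frac_fracD t x) [frac t + x]addrC.
  apply/seteqP; split => [x /=|x /=]; rewrite fE !in_itv /=.
    move=> [Ax /andP[x0 x1]]; have [xs|xs] := ltP (x + s) 1.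
      left; split; last by rewrite /= in_itv /= lerDr x0.
      rewrite -(@frac_eq _ (x + s) (x + s) 0) ?addr0 ?xs ?andbT //.
      exact: addr_ge0.
    right; have H : 0 <= x + (s - 1) < s by apply/andP; split; lra.
    split; last by rewrite /= in_itv.
    rewrite -(@frac_eq _ (x + s) (x + (s - 1)) 1) //; last by ring.
    by lra.
  move=> [|] [Ax]; rewrite /= in_itv /= => H.
    rewrite (@frac_eq _ (x + s) (x + s) 0) ?addr0 //; first by split=> //; lra.
    by lra.
  rewrite (@frac_eq _ (x + s) (x + (s - 1)) 1) //; [|lra|ring].
  by split=> //; lra.
have -> : A `&` `[0, 1[%classic = A1 `|` A2.
  rewrite -setIUr; congr (_ `&` _); apply/seteqP; split => x /=; rewrite !in_itv /=.
    by move=> /andP[x0 x1]; case: (ltP x s) => h; [right|left]; rewrite ?x0 ?x1.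
  by move=> [|] => H; lra.
rewrite !measureU //; try exact: msh.
- by congr (_ + _)%E; exact: lebesgue_measure_shift.
- by rewrite -subset0 => x /= [[_ +] [_ +]]; rewrite /= !in_itv /=; lra.
- by rewrite -subset0 => x /= [[_ +] [_ +]]; rewrite /= !in_itv /=; lra.
Qed.

Lemma rotation_mp_action {R : realType} (t : nat -> R) :
  (forall m n, (0 < m)%N -> (0 < n)%N -> t (m * n)%N = t m + t n) ->
  mp_action (unit_itv_measure R) (fun n x => frac (x + t n)).
Proof.
move=> tM; split; [|split] => [n n0|n A n0 mA|m n m0 n0].
- apply: measurableT_comp; first exact: measurable_frac.
  exact: measurable_shift.
- exact: unit_itv_measure_rot.
- by apply/funext => x /=; rewrite frac_fracD tM // addrAC addrA.
Qed.

Lemma rotation_not_recurrent {R : realType} {S : rat -> Prop} (t : nat -> R) (e : R) :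
  (forall m n, (0 < m)%N -> (0 < n)%N -> t (m * n)%N = t m + t n) -> 0 < e ->
  (forall m n (k : int), (0 < m)%N -> (0 < n)%N -> S (m%:Q / n%:Q) ->
     e <= `|t m - t n - k%:~R|) ->
  ~ mult_recurrence S /\ ~ top_mult_recurrence S.
Proof.
move=> tM e0 Se.
(* The difference of the fractional parts is [t m - t n] up to an integer. *)
have far x m n : (0 < m)%N -> (0 < n)%N -> S (m%:Q / n%:Q) ->
    e <= `|frac (x + t m) - frac (x + t n)|.
  move=> m0 n0 /(Se _ _ (Num.floor (x + t m) - Num.floor (x + t n)) m0 n0).
  by congr (_ <= `|_|); rewrite /frac intrB; ring.
split=> [rec|rec].
(* Two points of [B] are less than [e] apart. *)
- pose B : set (measurableTypeR R) := `[0, Num.min e 1[%classic.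
  have B1 : 0 < Num.min e 1 by rewrite lt_min e0 ltr01.
  have B0 : (0 < unit_itv_measure R B)%E.
    rewrite unit_itv_measureE setIidl; last first.
      by move=> x; rewrite /B /= !in_itv /= lt_min => /and3P[-> _ ->].
    by rewrite lebesgue_measure_itv /= lte_fin B1 oppr0 addr0 lte_fin.
  have mB : measurable B by exact: measurable_itv.
  have [m [n [m0 n0 Smn]]] := rec _ _ R _ _ (rotation_mp_action t tM) B mB B0.
  rewrite (_ : _ `&` _ = set0) ?measure0 ?ltxx //.
  rewrite -subset0 => x []; rewrite /B /= !in_itv /= !lt_min.
  by have := far x m n m0 n0 Smn; rewrite ler_normr => /orP[]; lra.
(* The colour of [n] is the interval of length [1 / (k + 1) < e] that contains [frac (t n)]. *)
- have [k ke] := ltr_add_invr e0; rewrite add0r in ke.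
  pose f n := k.+1%:R * frac (t n) : R.
  have f0 n : 0 <= f n by have := frac_itv (t n); rewrite /f => /andP[? _]; rewrite mulr_ge0.
  have fk n : (Num.truncn (f n) < k.+1)%N.
    rewrite -(ltr_nat R) (@le_lt_trans _ _ (f n)) ?truncn_le ?f0 //.
    by rewrite /f gtr_pMr //; have /andP[] := frac_itv (t n).
  have [i [m [n [m0 n0 cm cn Smn]]]] := rec _ (fun n => Ordinal (fk n)).
  have E : Num.truncn (f m) = Num.truncn (f n) by rewrite -cn in cm; case: cm.
  have := far 0 m n m0 n0 Smn; rewrite !add0r leNgt => /negP; apply.
  apply: lt_trans ke; rewrite -(ltr_pM2l (_ : 0 < k.+1%:R)) ?ltr0n // divff ?pnatr_eq0 //.
  rewrite -[X in X * _](@ger0_norm _ k.+1%:R) // -normrM mulrBr -/(f m) -/(f n).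
  have /andP[] := truncn_itv (f0 m); have /andP[] := truncn_itv (f0 n).
  by rewrite E -natr1 ltr_norml => *; lra.
Qed.

(** * The case of distinct leading coefficients *)

(* Only countably many [alpha] are of the form [k / ln q]. *)
Lemma generic_slope (R : realType) : exists alpha : R,
  forall (q : rat) (k : int), 0 < q -> q != 1 -> alpha * ln (ratr q) != k%:~R.
Proof.
pose f (p : rat * int) : R := p.2%:~R / ln (ratr p.1).
have cf : countable (range f).
  exact: sub_countable (card_image_le _ _) (countableP _).
have [alpha nf] : exists x, ~ range f x.
  apply: contrapT => /forallNP all_f.
  have : lebesgue_measure (`[0, 1]%classic : set R) = 0%E.
    apply: countable_lebesgue_measure0; apply: sub_countable cf.
    by apply: subset_card_le => x _; apply: contrapT.
  rewrite lebesgue_measure_itv /= lte_fin ltr01 oppr0 adde0 => -[] /eqP.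
  by rewrite oner_eq0.
exists alpha => q k q0 q1; apply/eqP => E; apply: nf; exists (q, k) => //.
by rewrite /f /= -E mulfK // ln_eq0 ?ltr0q // fmorph_eq1.
Qed.

Lemma dist_int_gt0 {R : realType} (y : R) : (forall k : int, y != k%:~R) ->
  exists2 e : R, 0 < e & forall k : int, e <= `|y - k%:~R|.
Proof.
move=> yk; have /andP[f1 f2] := floor_itv y.
have {}f1 : (Num.floor y)%:~R < y by rewrite lt_neqAle f1 eq_sym yk.
exists (Num.min (y - (Num.floor y)%:~R) ((Num.floor y + 1)%:~R - y)).
  by rewrite lt_min !subr_gt0 f1 f2.
move=> k; rewrite ge_min; apply/orP; have [kf|kf] := leP k (Num.floor y).
  left; rewrite ler_normr; apply/orP; left.
  by rewrite lerD2l lerN2 ler_int.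
right; rewrite ler_normr; apply/orP; right.
by rewrite opprB lerD2r ler_int lezD1.
Qed.

(** The difference equals [(a d - b c) / (c (c n + d))], and [c n + d >= m] as soon as
    [n >= |d| + m]. *)
Lemma Rset_tail {R : realType} {a c : nat} (b d : int) {r : R} :
  (0 < a)%N -> (0 < c)%N -> 0 < r ->
  exists N : nat, forall n, (N <= n)%N ->
    `|ratr (a%:R / c%:R) - ratr ((a%:Z * n%:Z + b)%:~R / (c%:Z * n%:Z + d)%:~R)| < r.
Proof.
move=> a0 c0 r0; pose D : R := `|a%:R * d%:~R - b%:~R * c%:R|.
pose m := (Num.bound (D / r)).+1.
exists (`|d| + m)%N => n nN.
rewrite !fmorph_div /= !ratr_nat !ratr_int !intrD !intrM -!pmulrn.
have cR : 1 <= c%:R :> R by rewrite ler1n.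
have mR : m%:R <= c%:R * n%:R + d%:~R :> R.
  by rewrite !pmulrn -intrM -intrD ler_int; nia.
have m0 : 0 < m%:R :> R by rewrite ltr0n.
have -> : a%:R / c%:R - (a%:R * n%:R + b%:~R) / (c%:R * n%:R + d%:~R) =
    (a%:R * d%:~R - b%:~R * c%:R) / (c%:R * (c%:R * n%:R + d%:~R)) :> R.
  by field; apply/andP; split; rewrite gt_eqF //; lra.
rewrite normrM normfV (@gtr0_norm _ (_ * _)); last by nra.
rewrite ltr_pdivrMr; last by nra.
apply: (@lt_le_trans _ _ (r * m%:R)); last by rewrite ler_pM2l //; nra.
rewrite [r * _]mulrC -ltr_pdivrMr // -/D.
have /archi_boundP Dr : 0 <= D / r by rewrite divr_ge0 ?normr_ge0 ?ltW.
by apply: (lt_le_trans Dr); rewrite ler_nat.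
Qed.

(** By continuity of [ln] at [a / c], the values for large [n] stay within [e / 2] of
    [alpha * ln (a / c)], which is at distance at least [e] from the integers. The finitely many
    others are treated one by one. *)
Lemma Rset_far {R : realType} {a c : nat} (b d : int) :
  (0 < a)%N -> (0 < c)%N -> a != c ->
  exists (alpha : R) (e : R), 0 < e /\
    forall (q : rat) (k : int), Rset a b c d q -> e <= `|alpha * ln (ratr q) - k%:~R|.
Proof.
move=> a0 c0 ac; have [alpha Ha] := generic_slope R; exists alpha.
pose q0 : rat := a%:R / c%:R.
have q00 : 0 < q0 by rewrite divr_gt0 ?ltr0n.
have q01 : q0 != 1.
  apply: contra ac => /eqP E; rewrite -(eqr_nat rat).
  by rewrite -(divfK (_ : c%:R != 0 :> rat) a%:R) ?pnatr_eq0 -?lt0n // -/q0 E mul1r.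
have [e e0 He] := dist_int_gt0 _ (fun k => Ha q0 k q00 q01).
pose q_ n : rat := (a%:Z * n%:Z + b)%:~R / (c%:Z * n%:Z + d)%:~R.
have [N HN] : exists N : nat, forall n, (N <= n)%N ->
    `|alpha * ln (ratr q0) - alpha * ln (ratr (q_ n))| < e / 2.
  have cg : {for (ratr q0 : R), continuous (fun x : R => alpha * ln x)}.
    by apply: continuousM; [exact: cst_continuous|apply: continuous_ln; rewrite ltr0q].
  have /nbhs_ballP[r r0 Hr] : \forall x \near (ratr q0 : R),
      `|alpha * ln (ratr q0) - alpha * ln x| < e / 2.
    by move/cvgrPdist_lt: cg; apply; rewrite divr_gt0.
  have [N HN] := Rset_tail b d a0 c0 r0.
  by exists N => n nN; apply: Hr; apply: HN.
have [e1 e10 He1] : exists2 e1 : R, 0 < e1 & forall n, (n < N)%N ->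
    0 < q_ n -> q_ n != 1 -> forall k : int, e1 <= `|alpha * ln (ratr (q_ n)) - k%:~R|.
  elim: (N) => [|M [e1 e10 IH]]; first by exists 1.
  have [/andP[qM0 qM1]|nq] := boolP ((0 < q_ M) && (q_ M != 1)).
    have [e2 e20 He2] := dist_int_gt0 _ (fun k => Ha (q_ M) k qM0 qM1).
    exists (Num.min e1 e2); first by rewrite lt_min e10.
    move=> n; rewrite ltnS leq_eqVlt => /predU1P[->|nM] n0 n1 k.
      by rewrite ge_min He2 orbT.
    by rewrite ge_min IH.
  exists e1 => // n; rewrite ltnS leq_eqVlt => /predU1P[->|nM]; last exact: IH.
  by move=> h1 h2; rewrite h1 h2 in nq.
exists (Num.min (e / 2) e1); split; first by rewrite lt_min e10 divr_gt0.
move=> q k [[n [n0 [_ ->]]] []]; rewrite -/(q_ n) => h1 h2.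
have [Nn|nN] := leqP N n; last by rewrite ge_min He1 // orbT.
rewrite ge_min; apply/orP; left.
have := HN n Nn; have := He k.
rewrite ltr_norml !ler_normr => /orP[] h /andP[h3 h4]; apply/orP; [left|right]; lra.
Qed.

Lemma Rset_not_recurrent_neq {a c : nat} (b d : int) :
  (0 < a)%N -> (0 < c)%N -> a != c ->
  ~ mult_recurrence (Rset a b c d) /\ ~ top_mult_recurrence (Rset a b c d).
Proof.
(* [mult_recurrence] quantifies over all real types, so an action over a single one refutes it. *)
move=> a0 c0 ac; have [alpha [e [e0 He]]] := @Rset_far Rdefinitions.R _ _ b d a0 c0 ac.
apply: (@rotation_not_recurrent Rdefinitions.R _ (fun n => alpha * ln n%:R) e) => //.
  by move=> m n m0 n0; rewrite natrM lnM ?posrE ?ltr0n // mulrDr.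
move=> m n k m0 n0 /He; rewrite -mulrBr -ln_div ?posrE ?ltr0n //.
by rewrite fmorph_div /= !ratr_int.
Qed.

Local Close Scope classical_set_scope.

(** * Equal leading coefficients: p-adic valuations *)

Lemma not_dvd_lcm_prime {a : nat} {b d : int} : (0 < a)%N ->
  ~~ (a%:Z %| lcmz b d)%Z -> b != 0 /\ d != 0 /\
  exists p, [/\ prime p, (logn p `|b| < logn p a)%N & (logn p `|d| < logn p a)%N].
Proof.
move=> a0 nal.
have b0 : b != 0 by apply: contraNneq nal => ->; rewrite lcm0z dvdz0.
have d0 : d != 0 by apply: contraNneq nal => ->; rewrite lcmz0 dvdz0.
have bn0 : (0 < `|b|)%N by rewrite absz_gt0.
have dn0 : (0 < `|d|)%N by rewrite absz_gt0.
split=> //; split=> //; apply: contrapT => nop; move/negP: nal; apply.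
rewrite /lcmz dvdzE /=; apply/dvdn_partP => // p pa.
have pp : prime p by move: pa; rewrite mem_primes => /andP[].
have ln0 : (0 < lcmn `|b| `|d|)%N by rewrite lcmn_gt0 bn0.
rewrite p_part pfactor_dvdn // logn_lcm // leq_max.
rewrite [X in X || _]leqNgt [X in _ || X]leqNgt -negb_and.
by apply/negP => /andP[h1 h2]; apply: nop; exists p.
Qed.

(** The term [a n] has a strictly larger valuation than [b], so the ultrametric inequality is an
    equality. *)
Lemma logn_absz_affine {a p : nat} {b : int} (n : nat) : (0 < a)%N -> prime p ->
  b != 0 -> (logn p `|b| < logn p a)%N -> a%:Z * n%:Z + b != 0 ->
  logn p `|a%:Z * n%:Z + b| = logn p `|b|.
Proof.
move=> a0 pp b0 lba u0.
have pv x k : x != 0 -> (k <= logn p `|x|)%N = ((p ^ k)%N%:Z %| x)%Z.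
  by move=> x0; rewrite dvdzE -pfactor_dvdn ?absz_gt0.
have pan k : (k <= logn p a)%N -> ((p ^ k)%N%:Z %| a%:Z * n%:Z)%Z.
  by move=> ka; rewrite dvdz_mulr // dvdzE pfactor_dvdn.
apply/eqP; rewrite eqn_leq; apply/andP; split.
  by rewrite leqNgt pv // rpredDl ?pan // -pv // ltnn.
by rewrite pv // rpredDl ?pan ?(ltnW lba) // -pv.
Qed.

(** Clearing denominators gives an equation in naturals, to which valuations and prime-to-p parts
    apply. Numerator and denominator may both be negative, hence the absolute values. *)
Lemma Rset_ratio {a c m n : nat} {b d : int} : (0 < m)%N -> (0 < n)%N ->
  Rset a b c d (m%:Q / n%:Q) ->
  exists k : nat, let u := a%:Z * k%:Z + b in let w := c%:Z * k%:Z + d in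
    [/\ u != 0, w != 0, (0 < u) = (0 < w) & (m * `|w| = n * `|u|)%N].
Proof.
move=> m0 n0 [[k [k0 [w0 qE]]] [q0 _]]; exists k => u w.
have n0Q : n%:Q != 0 by rewrite intr_eq0 -lt0n.
have w0Q : w%:~R != 0 :> rat by rewrite intr_eq0.
have uw : 0 < u%:~R * w%:~R :> rat.
  have : 0 < (u%:~R / w%:~R) * (w%:~R * w%:~R) :> rat.
    by rewrite -qE mulr_gt0 // -expr2 exprn_even_gt0.
  by rewrite mulrA divfK.
rewrite -intrM ltr0z in uw.
have u0 : u != 0 by apply: contraTneq uw => ->; rewrite mul0r.
split=> //.
  by apply/idP/idP => h; [rewrite (pmulr_rgt0 _ h) in uw|rewrite (pmulr_lgt0 _ h) in uw].
move/eqP: qE; rewrite eqr_div // -!intrM eqr_int => /eqP /(congr1 absz).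
by rewrite !abszM /= => ->; rewrite mulnC.
Qed.

(* The p-adic valuation of every element of R_{a,b,a,d} is the nonzero constant
   v_p(b) - v_p(d). *)
Lemma Rset_not_recurrent_val {a p : nat} {b d : int} : (0 < a)%N -> prime p ->
  b != 0 -> d != 0 -> (logn p `|b| < logn p a)%N -> (logn p `|d| < logn p a)%N ->
  logn p `|b| <> logn p `|d| ->
  ~ mult_recurrence (Rset a b a d) /\ ~ top_mult_recurrence (Rset a b a d).
Proof.
move=> a0 pp b0 d0 ba da bd.
(* [M] exceeds the absolute value of the nonzero constant [v_p(b) - v_p(d)], which is therefore at
   distance at least 1 from every multiple of [M]. *)
pose M := (logn p `|b| + logn p `|d|).+1.
have M0 : 0 < M%:R :> Rdefinitions.R by rewrite ltr0n.
apply: (@rotation_not_recurrent Rdefinitions.R _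
  (fun n => (logn p n)%:R / M%:R) M%:R^-1); last 1 first.
- move=> m n k m0 n0 /(Rset_ratio m0 n0)[j [u0 w0 _ E]].
  have := congr1 (logn p) E.
  rewrite !lognM ?absz_gt0 // !logn_absz_affine // => lE.
  have -> : (logn p m)%:R / M%:R - (logn p n)%:R / M%:R - k%:~R =
      ((logn p m)%:Z - (logn p n)%:Z - k * M%:Z)%:~R / M%:R :> Rdefinitions.R.
    by rewrite !intrB intrM -!pmulrn; field; rewrite pnatr_eq0.
  rewrite normrM normfV (@ger0_norm _ M%:R) ?ler0n // ler_peMl ?invr_ge0 ?ler0n //.
  rewrite -intr_norm ler1z /M.
  move: lE bd; move: (logn p m) (logn p n) (logn p `|b|) (logn p `|d|) => x y z t E1 E2.
  have kM : k * (z + t).+1%:Z = 0 \/ k * (z + t).+1%:Z <= - (z + t).+1%:Z \/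
      (z + t).+1%:Z <= k * (z + t).+1%:Z.
    have [h|h|->] := ltgtP k 0; last by rewrite mul0r; left.
      by right; left; rewrite -mulN1r ler_wpM2r //; lia.
    by right; right; rewrite ler_peMl //; lia.
  by move: kM; move: (k * _) => K; lia.
- by move=> m n m0 n0; rewrite lognM // natrD mulrDl.
- by rewrite invr_gt0.
Qed.

(** * Equal leading coefficients: residues modulo a prime power *)

Local Open Scope classical_set_scope.

(** The uniform measure on the residues modulo [N], as an average of Dirac masses on [nat]. *)
Definition uniform_below (R : realType) (N : nat) : set nat -> \bar R :=
  mscale (N%:R^-1)%:nng (msum (fun i => \d_i) N).

HB.instance Definition _ (R : realType) (N : nat) := Measure.on (uniform_below R N).

Lemma uniform_belowE {R : realType} (N : nat) (A : set nat) :
  uniform_below R N A = (N%:R^-1 * \sum_(i < N) (nat_of_ord i \in A)%:R)%:E.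
Proof.
by rewrite /uniform_below /mscale /= /msum EFinM -sumEFin; congr (_ * _)%E.
Qed.

Lemma uniform_belowT (R : realType) (N : nat) : uniform_below R N.+1 setT = 1%E.
Proof.
rewrite uniform_belowE (eq_bigr (fun=> 1)); last by move=> i _; rewrite in_setT.
by rewrite sumr_const card_ord mulVf // pnatr_eq0.
Qed.

HB.instance Definition _ (R : realType) (N : nat) :=
  Measure_isProbability.Build _ _ _ (uniform_below R N.+1) (uniform_belowT R N).

Lemma eqn_modMl_coprime (N m x y : nat) : coprime N m ->
  (m * x == m * y %[mod N])%N = (x == y %[mod N])%N.
Proof.
move=> cN; wlog yx : x y / (y <= x)%N.
  by move=> H; have [/H //|/ltnW /H E] := leqP y x; rewrite eq_sym E eq_sym.
by rewrite !eqn_mod_dvd ?leq_mul2l ?yx ?orbT // -mulnBr Gauss_dvdr.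
Qed.

Lemma coprime_partC_prime (p n K : nat) : prime p -> coprime (p ^ K) (n`_p^')%N.
Proof.
move=> pp; rewrite coprimeXl // prime_coprime //; apply/negP => pn.
by have := pnat_dvd pn (part_pnat _ _); rewrite pnatE // !inE eqxx.
Qed.

(** Multiplication by a unit permutes the residues, which reindexes the sum. *)
Lemma uniform_below_mul {R : realType} {N k : nat} (A : set nat) : coprime N.+1 k ->
  uniform_below R N.+1 ((fun x => (x * k) %% N.+1)%N @^-1` A) = uniform_below R N.+1 A.
Proof.
move=> ck; rewrite !uniform_belowE; congr (_ * _)%:E.
pose h (i : 'I_N.+1) : 'I_N.+1 := Ordinal (ltn_pmod (i * k) (ltn0Sn N)).
have hI : injective h.
  move=> i j /(congr1 val) /= /eqP.
  rewrite ![(_ * k)%N]mulnC eqn_modMl_coprime // !modn_small // => /eqP.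
  exact: val_inj.
rewrite [RHS](reindex_inj hI); apply: eq_bigr => i _.
by congr (nat_of_bool _)%:R; apply/idP/idP; rewrite !inE.
Qed.

Lemma unit_mod_mp_action (R : realType) (N : nat) (v : nat -> nat) :
  (forall n, (0 < n)%N -> coprime N.+1 (v n)) ->
  (forall m n, (0 < m)%N -> (0 < n)%N -> v (m * n)%N = (v m * v n)%N) ->
  mp_action (uniform_below R N.+1) (fun n x => (x * v n) %% N.+1)%N.
Proof.
move=> cv vM; split; [by []|split] => [n A n0 _|m n m0 n0].
  by apply: uniform_below_mul; exact: cv.
by apply/funext => x /=; rewrite modnMml vM // -mulnA (mulnC (v n)).
Qed.

Lemma absz_sub_same_sign {u w : int} : (0 < u) = (0 < w) ->
  `|(`|w|%N%:Z - `|u|%N%:Z)%R|%N = `|(u - w)%R|%N.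
Proof.
by case: (ltP 0 u) => u1 /esym; [|move/negbT; rewrite -leNgt]; lia.
Qed.

(* When b and d have the same valuation v < v_p(a), the prime-to-p parts of a n + b and
   a n + d are never congruent modulo p ^ `|b - d|, since their difference is
   (b - d) / p ^ v. *)
Lemma Rset_coprime_part {a p m n : nat} {b d : int} : (0 < a)%N -> prime p ->
  b != 0 -> d != 0 -> b != d ->
  (logn p `|b| < logn p a)%N -> logn p `|b| = logn p `|d| ->
  (0 < m)%N -> (0 < n)%N -> Rset a b a d (m%:Q / n%:Q) ->
  (m`_p^' != n`_p^' %[mod p ^ `|b - d|])%N.
Proof.
move=> a0 pp b0 d0 bd ba lbd m0 n0 /(Rset_ratio m0 n0)[j [u0 w0 uw E]].
set u := (_ + b) in u0 uw E *; set w := (_ + d) in w0 uw E *.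
have lu : logn p `|u| = logn p `|b| by exact: logn_absz_affine.
have lw : logn p `|w| = logn p `|b| by rewrite lbd logn_absz_affine // -lbd.
have un0 : (0 < `|u|)%N by rewrite absz_gt0.
have wn0 : (0 < `|w|)%N by rewrite absz_gt0.
pose K := `|b - d|%N.
have E' : (m`_p^' * `|w| `_p^' = n`_p^' * `|u| `_p^')%N by rewrite -!partnM // E.
apply/negP => /eqP mn.
have wu : (`|w| `_p^' == `|u| `_p^' %[mod p ^ K])%N.
  rewrite -(eqn_modMl_coprime _ (m`_p^')%N) ?coprime_partC_prime // E'.
  by rewrite -modnMml -mn modnMml.
(* [u] and [w] have the same p-part, which is multiplied back in. *)
have {}wu : (`|w| == `|u| %[mod p ^ K])%N.
  rewrite -(partnC p wn0) -(partnC p un0) !p_part lu lw -modnMmr (eqP wu).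
  by rewrite modnMmr.
have : ((p ^ K)%N%:Z %| `|w|%N%:Z - `|u|%N%:Z)%Z.
  by rewrite -eqz_mod_dvd !modz_nat eqz_nat.
have D : u - w = b - d by rewrite /u /w; ring.
rewrite dvdzE (absz_sub_same_sign uw) D.
(* The exponent [K = |b - d|] ensures [p ^ K > |b - d| > 0]. *)
rewrite gtnNdvd ?absz_gt0 ?subr_eq0 //; exact: ltn_expl (prime_gt1 pp).
Qed.

Lemma Rset_not_recurrent_unit {a p : nat} {b d : int} : (0 < a)%N -> prime p ->
  b != 0 -> d != 0 -> b != d ->
  (logn p `|b| < logn p a)%N -> logn p `|b| = logn p `|d| ->
  ~ mult_recurrence (Rset a b a d) /\ ~ top_mult_recurrence (Rset a b a d).
Proof.
move=> a0 pp b0 d0 bd ba lbd; pose K := `|b - d|%N.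
have pK0 : (0 < p ^ K)%N by rewrite expn_gt0 prime_gt0.
have K0 : (0 < K)%N by rewrite absz_gt0 subr_eq0.
have neq m n := @Rset_coprime_part a p m n b d a0 pp b0 d0 bd ba lbd.
have pK1 : (1 < p ^ K)%N.
  by rewrite (leq_trans (prime_gt1 pp)) // -{1}(expn1 p) leq_exp2l ?prime_gt1.
split=> rec; last first.
  have [i [m [n [m0 n0 cm cn Smn]]]] := rec _ (fun n => Ordinal (ltn_pmod (n`_p^')%N pK0)).
  have /negP := neq m n m0 n0 Smn; apply; apply/eqP.
  by rewrite -cn in cm; case: cm.
pose N := (p ^ K).-1; have NE : N.+1 = (p ^ K)%N by rewrite prednK.
have act : mp_action (uniform_below Rdefinitions.R N.+1) (fun n x => (x * n`_p^') %% N.+1)%N.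
  by apply: unit_mod_mp_action => *; [rewrite NE coprime_partC_prime|rewrite partnM].
have B0 : (0 < uniform_below Rdefinitions.R N.+1 [set 1%N])%E.
  have N1 : (1 < N.+1)%N by rewrite NE.
  rewrite uniform_belowE lte_fin mulr_gt0 ?invr_gt0 ?ltr0n // (bigD1 (Ordinal N1)) //=.
  by rewrite ltr_wpDr ?sumr_ge0 // mem_set.
have [m [n [m0 n0 Smn]]] := rec _ _ _ _ _ act [set 1%N] I B0.
rewrite (_ : _ `&` _ = set0) ?measure0 ?ltxx //.
rewrite -subset0 => x [] /= xm xn.
have /negP := neq m n m0 n0 Smn; apply; rewrite -NE.
have xm1 : (x * m`_p^' = 1 %[mod N.+1])%N by rewrite xm modn_small // NE.
have xn1 : (x * n`_p^' = 1 %[mod N.+1])%N by rewrite xn modn_small // NE.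
(* With [m'], [n'] the prime-to-p parts, [m' = (x n') m' = (x m') n' = n'] modulo [p ^ K]. *)
apply/eqP; rewrite -[in LHS](mul1n (m`_p^')%N) -modnMml -xn1 modnMml mulnAC.
by rewrite -modnMml xm1 modnMml mul1n.
Qed.

Lemma Rset_not_recurrent_eq {a : nat} {b d : int} : (0 < a)%N -> b != d ->
  ~~ (a%:Z %| lcmz b d)%Z ->
  ~ mult_recurrence (Rset a b a d) /\ ~ top_mult_recurrence (Rset a b a d).
Proof.
move=> a0 bd /(not_dvd_lcm_prime a0)[b0 [d0 [p [pp ba da]]]].
have [E|/eqP E] := eqVneq (logn p `|b|) (logn p `|d|).
  exact: Rset_not_recurrent_unit ba E.
exact: Rset_not_recurrent_val ba da E.
Qed.

Local Close Scope classical_set_scope.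

Theorem theorem1p1 (a c : nat) (b d : int) :
  (0 < a)%N -> (0 < c)%N ->
  (exists q : rat, Rset a b c d q) ->
  (mult_recurrence (Rset a b c d) <-> top_mult_recurrence (Rset a b c d)) /\
  (top_mult_recurrence (Rset a b c d) <->
     (a = c /\ (a%:Z %| lcmz b d)%Z)).
Proof.
move=> a0 c0 [q [[n [n0 [dn qE]]] [_ q1]]].
have [[ac aL]|nac] := pselect (a = c /\ (a%:Z %| lcmz b d)%Z).
  (* If [b = d], the given element of R would be 1. *)
  subst c; have bd : b != d.
    by apply: contraNneq q1 => bd; rewrite qE bd divff // intr_eq0.
  have HR := Rset_chains a0 bd aL.
  split; split=> _ //; [exact: chains_top_recurrence|exact: chains_mult_recurrence|].
  exact: chains_top_recurrence.
have [nm nt] : ~ mult_recurrence (Rset a b c d) /\ ~ top_mult_recurrence (Rset a b c d).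
  have [ac|ac] := eqVneq a c; last exact: Rset_not_recurrent_neq.
  subst c; apply: Rset_not_recurrent_eq => //; last by apply/negP => aL; apply: nac.
  by apply: contraNneq q1 => bd; rewrite qE bd divff // intr_eq0.
by split; split.
Qed.
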